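(* Let $\pi\in\Delta_k$ and let $L^{(1)},L^{(2)}:\mathbb{R}^k\times[k]\to\mathbb{R}\cup\{+\infty\}$ be bounded below loss functions. For $j=1,2$ define, for $t\in\mathbb{R}^{k-1}_+$, $$f^{(j)}_\pi(t)=\sup_{\alpha\in\mathbb{R}^k}\Big(H_{L^{(j)}}(\pi)-\sum_{i=1}^{k-1}\pi_iL^{(j)}(\alpha,i)t_i-\pi_kL^{(j)}(\alpha,k)\Big),\qquad H_{L^{(j)}}(\pi)=\inf_{\alpha\in\mathbb{R}^k}\sum_{i=1}^k\pi_iL^{(j)}(\alpha,i).$$ Then $L^{(1)}$ and $L^{(2)}$ are universally equivalent with respect to the prior $\pi$ if and only if there exist $a>0$, $b\in\mathbb{R}^{k-1}$, and $c\in\mathbb{R}$ such that $$f^{(1)}_\pi(t)=af^{(2)}_\pi(t)+b^Tt+c\quad\text{for all }t\in\mathbb{R}^{k-1}_+.$$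
   Context: $[k]=\{1,\ldots,k\}$, $\Delta_k=\{p\in\mathbb{R}^k_+ : \mathbf{1}^Tp=1\}$. Given a prior $\pi\in\Delta_k$ and probability distributions $P_1,\ldots,P_k$ on a measurable space $\mathcal{X}$, draw $Y\in[k]$ with $\mathbb{P}(Y=y)=\pi_y$ and, conditional on $Y=y$, $X\sim P_y$. A quantizer is a measurable map $\mathsf{q}:\mathcal{X}\to\mathcal{Z}$ into a measurable space $\mathcal{Z}$; $\widetilde\pi(\mathsf{q}(X))\in\Delta_k$ is the posterior distribution of $Y$ given $\mathsf{q}(X)$. For a loss $L$ with entropy $H_L(\pi)=\inf_\alpha\sum_y\pi_yL(\alpha,y)$, the quantized statistical information is $I(\pi,P_{1:k};H_L,\mathsf{q})=H_L(\pi)-\mathbb{E}[H_L(\widetilde\pi(\mathsf{q}(X)))]$. Losses $L^{(1)},L^{(2)}$ are universally equivalent for the prior $\pi$ if for any distributions $P_1,\ldots,P_k$ (on any $\mathcal{X}$) and any quantizers $\mathsf{q}_1,\mathsf{q}_2$ of $\mathcal{X}$: $I(\pi,P_{1:k};H_{L^{(1)}},\mathsf{q}_1)\le I(\pi,P_{1:k};H_{L^{(1)}},\mathsf{q}_2)$ if and only if $I(\pi,P_{1:k};H_{L^{(2)}},\mathsf{q}_1)\le I(\pi,P_{1:k};H_{L^{(2)}},\mathsf{q}_2)$.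
   Formalization: The entropies of both losses at the prior are assumed finite (otherwise f and the information are ∞−∞), and a zero weight times an infinite loss is read as +∞ (with 0·∞=0 the claim fails, e.g. for a two-class loss with an action of losses (−5,+∞) and all others 0). *)

(* Defs.v *)
From HB Require Import structures.
From mathcomp Require Import all_boot all_order all_algebra.
From mathcomp Require Import all_classical all_reals all_analysis.

Set Implicit Arguments.
Unset Strict Implicit.
Unset Printing Implicit Defensive.

Import Order.TTheory GRing.Theory Num.Theory.
Import numFieldNormedType.Exports.

Local Open Scope classical_set_scope.
Local Open Scope ring_scope.

(* The k classes are indexed by 'I_k; vectors of R^k are rows 'rV[R]_k. *)

Definition simplex (R : realType) (k : nat) : set 'rV[R]_k :=
  [set p | (forall i, 0 <= p 0 i) /\ \sum_i p 0 i = 1].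

Definition nonneg_orthant (R : realType) (m : nat) : set 'rV[R]_m :=
  [set t | forall i, 0 <= t 0 i].

(* A loss takes values in R u {+oo}: the value -oo is excluded by
   bounded_below. *)
Definition loss (R : realType) (k : nat) := 'rV[R]_k -> 'I_k -> \bar R.

Definition bounded_below (R : realType) (k : nat) (L : loss R k) : Prop :=
  exists m : R, forall (al : 'rV[R]_k) (y : 'I_k), (m%:E <= L al y)%E.

(* The term w * l of a weighted sum of losses, with the convex-analytic
   convention 0 * +oo = +oo: an infinite loss marks an infeasible action, which
   is never taken, even when the class has weight 0. This is what makes the
   entropy and f_pi below an infimum and a supremum of affine functions, hence
   closed, up to the boundary of the orthant. It differs from the product of
   extended reals, for which 0 * +oo = 0. *)
Definition weighted (R : realType) (w : R) (l : \bar R) : \bar R :=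
  if l == +oo%E then +oo%E else (w%:E * l)%E.

Definition entropy (R : realType) (k : nat) (L : loss R k) (p : 'rV[R]_k) :
    \bar R :=
  ereal_inf [set (\sum_(y < k) weighted (p 0%R y) (L al y))%E
            | al in [set: 'rV[R]_k]].

(* With k = n.+1 classes, the last class k is ord_max and the class i < k
   is widen_ord (leqnSn n) i. *)
Definition f_pi (R : realType) (n : nat) (L : loss R n.+1)
    (pi : 'rV[R]_n.+1) (t : 'rV[R]_n) : \bar R :=
  ereal_sup [set (entropy L pi
      - (\sum_(i < n) weighted (pi 0%R (widen_ord (leqnSn n) i) * t 0%R i)%R
                               (L al (widen_ord (leqnSn n) i)))
      - weighted (pi 0%R ord_max) (L al ord_max))%E
    | al in [set: 'rV[R]_n.+1]].

(* E[h(Y, X)] when P(Y = y) = pi_y and X ~ P_y conditionally on Y = y. *)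
Definition joint_expectation (R : realType) (k : nat) (d : measure_display)
    (X : measurableType d) (pi : 'rV[R]_k) (P : 'I_k -> probability X R)
    (h : 'I_k -> X -> \bar R) : \bar R :=
  (\sum_(y < k) (pi 0%R y)%:E * \int[P y]_x h y x)%E.

(* post : Z -> Delta_k is a version of z |-> P(Y = . | q(X) = z):
   E[post_y(q(X)) 1_B(q(X))] = P(Y = y, q(X) \in B) for all y and measurable B.
   Versions agree almost surely under the law of q(X). *)
Definition is_posterior (R : realType) (k : nat) (d d' : measure_display)
    (X : measurableType d) (Z : measurableType d') (pi : 'rV[R]_k)
    (P : 'I_k -> probability X R) (q : X -> Z) (post : Z -> 'rV[R]_k) : Prop :=
  [/\ forall z, simplex (post z),
      forall y, measurable_fun [set: Z] (fun z => post z 0 y)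
    & forall (y : 'I_k) (B : set Z), measurable B ->
        joint_expectation pi P
          (fun _ x => (post (q x) 0 y * \1_B (q x))%:E) =
        joint_expectation pi P
          (fun y' x => ((y' == y)%:R * \1_B (q x))%:E)].

Definition information (R : realType) (k : nat) (d d' : measure_display)
    (X : measurableType d) (Z : measurableType d') (pi : 'rV[R]_k)
    (P : 'I_k -> probability X R) (H : 'rV[R]_k -> \bar R) (q : X -> Z)
    (post : Z -> 'rV[R]_k) : \bar R :=
  (H pi - joint_expectation pi P (fun _ x => H (post (q x))))%E.

Definition universally_equivalent (R : realType) (k : nat) (pi : 'rV[R]_k)
    (L1 L2 : loss R k) : Prop :=
  forall (d d1 d2 : measure_display) (X : measurableType d)
    (Z1 : measurableType d1) (Z2 : measurableType d2)
    (P : 'I_k -> probability X R)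
    (q1 : X -> Z1) (q2 : X -> Z2)
    (post1 : Z1 -> 'rV[R]_k) (post2 : Z2 -> 'rV[R]_k),
    measurable_fun [set: X] q1 -> measurable_fun [set: X] q2 ->
    is_posterior pi P q1 post1 -> is_posterior pi P q2 post2 ->
    (information pi P (entropy L1) q1 post1
       <= information pi P (entropy L1) q2 post2)%E <->
    (information pi P (entropy L2) q1 post1
       <= information pi P (entropy L2) q2 post2)%E.

(* Main.v *)
Require Import Defs.
From HB Require Import structures.
From mathcomp Require Import all_boot all_order all_algebra.
From mathcomp Require Import all_classical all_reals all_analysis.
From mathcomp Require Import measurable_realfun ring lra.

Set Implicit Arguments.
Unset Strict Implicit.
Unset Printing Implicit Defensive.

Import Order.TTheory GRing.Theory Num.Theory.
Import numFieldNormedType.Exports.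

Local Open Scope classical_set_scope.
Local Open Scope ring_scope.

(** Let S be the set of the finite risk vectors of a loss. On the simplex its
    entropy is H(p) = inf_(r in S) p.r, and this formula extends H to the
    orthant as a finite, superadditive and positively homogeneous function
    (entropyE). Moreover f_pi(t) = H(pi) - H(pi_1 t_1, ..., pi_k) (f_piE). By
    homogeneity the affine relation between the two functions f_pi is therefore
    the same as a relation H1 = a H2 + linear on the cone of the vectors that
    vanish wherever pi does (affinely_related_f).

    If this relation holds, integrate it over the posterior of a quantizer. The
    posterior lies in the cone almost surely and has mean pi, so the linear term
    contributes the same constant for every quantizer, and a > 0 preserves the
    comparisons (affinely_related_universally_equivalent).

    Conversely, a quantizer of a finite space cuts pi into the vectors v_z of
    joint masses of its cells, and by homogeneity its information is
    H(pi) - sum_z H(v_z). Take an experiment with five outcomes, of joint masses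
    u, v, u', v' and a remainder. The quantizers that merge the first two,
    respectively the next two, differ in information by the difference of the
    gaps H(u + v) - H(u) - H(v) and H(u' + v') - H(u') - H(v'). Universal
    equivalence thus says that both losses order the gaps in the same way
    (universally_equivalent_gaps). The gaps are nonnegative and can be rescaled
    at will, so two gap functions ordered alike are proportional
    (same_order_proportional): gap1 = a gap2 with a > 0. Then H1 - a H2 is
    additive and positively homogeneous on the cone, that is, linear. *)

(** * Bayes risk of a set of risk vectors *)

Definition dot (R : realType) (k : nat) (p r : 'rV[R]_k) : R :=
  \sum_y p 0 y * r 0 y.

Lemma dotDl (R : realType) (k : nat) (p q r : 'rV[R]_k) :
  dot (p + q) r = dot p r + dot q r.
Proof.
by rewrite /dot -big_split; apply: eq_bigr => y _; rewrite mxE mulrDl.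
Qed.

Lemma dotZl (R : realType) (k : nat) (a : R) (p r : 'rV[R]_k) :
  dot (a *: p) r = a * dot p r.
Proof. by rewrite /dot mulr_sumr; apply: eq_bigr => y _; rewrite mxE mulrA. Qed.

Lemma ler_dotr (R : realType) (k : nat) (p r s : 'rV[R]_k) :
  nonneg_orthant p -> (forall y, r 0 y <= s 0 y) -> dot p r <= dot p s.
Proof. by move=> p0 rs; apply: ler_sum => y _; exact: ler_wpM2l. Qed.

Definition bayes_risk (R : realType) (k : nat) (S : set 'rV[R]_k)
  (p : 'rV[R]_k) : R := inf [set dot p r | r in S].

Definition proper_risks (R : realType) (k : nat) (S : set 'rV[R]_k) : Prop :=
  S !=set0 /\ exists m : R, forall r, S r -> forall y, m <= r 0 y.

Lemma nonneg_orthantD (R : realType) (k : nat) (p q : 'rV[R]_k) :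
  nonneg_orthant p -> nonneg_orthant q -> nonneg_orthant (p + q).
Proof. by move=> p0 q0 y; rewrite mxE addr_ge0. Qed.

Lemma nonneg_orthantZ (R : realType) (k : nat) (a : R) (p : 'rV[R]_k) :
  0 <= a -> nonneg_orthant p -> nonneg_orthant (a *: p).
Proof. by move=> a0 p0 y; rewrite mxE mulr_ge0. Qed.

Lemma nonneg_orthant_delta (R : realType) (k : nat) (y : 'I_k) :
  nonneg_orthant (delta_mx 0 y : 'rV[R]_k).
Proof. by move=> j; rewrite mxE ler0n. Qed.

Lemma proper_has_inf (R : realType) (k : nat) (S : set 'rV[R]_k)
    (p : 'rV[R]_k) :
  proper_risks S -> nonneg_orthant p -> has_inf [set dot p r | r in S].
Proof.
move=> [[r0 Sr0] [m mS]] p0; split; first by exists (dot p r0), r0.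
exists (dot p (const_mx m)) => _ [r Sr <-].
by apply: ler_dotr => // y; rewrite mxE; exact: mS.
Qed.

Lemma bayes_risk_le (R : realType) (k : nat) (S : set 'rV[R]_k)
    (p r : 'rV[R]_k) :
  proper_risks S -> nonneg_orthant p -> S r -> bayes_risk S p <= dot p r.
Proof.
move=> pS p0 Sr; apply: ge_inf; last by exists r.
by case: (proper_has_inf pS p0).
Qed.

Lemma le_bayes_risk (R : realType) (k : nat) (S : set 'rV[R]_k)
    (p : 'rV[R]_k) (x : R) :
  S !=set0 -> (forall r, S r -> x <= dot p r) -> x <= bayes_risk S p.
Proof.
move=> [r0 Sr0] xS; apply: lb_le_inf; first by exists (dot p r0), r0.
by move=> _ [r Sr <-]; exact: xS.
Qed.

Lemma bayes_risk_adherent (R : realType) (k : nat) (S : set 'rV[R]_k)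
    (p : 'rV[R]_k) (e : R) :
  proper_risks S -> nonneg_orthant p -> 0 < e ->
  exists2 r, S r & dot p r < bayes_risk S p + e.
Proof.
move=> pS p0 e0; have [_ [r Sr <-] lt] := inf_adherent e0 (proper_has_inf pS p0).
by exists r.
Qed.

Lemma bayes_riskZ (R : realType) (k : nat) (S : set 'rV[R]_k) (a : R)
    (p : 'rV[R]_k) :
  proper_risks S -> 0 <= a -> nonneg_orthant p ->
  bayes_risk S (a *: p) = a * bayes_risk S p.
Proof.
move=> pS a0 p0; have [S0 _] := pS; apply/eqP; rewrite eq_le; apply/andP; split.
  apply/ler_addgt0Pr => e e0.
  have a1 : 0 < a + 1 by rewrite ltr_wpDl.
  have [r Sr lt] := bayes_risk_adherent pS p0 (divr_gt0 e0 a1).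
  apply: (le_trans (bayes_risk_le pS (nonneg_orthantZ a0 p0) Sr)).
  rewrite dotZl; apply: (le_trans (ler_wpM2l a0 (ltW lt))).
  rewrite mulrDr lerD2l mulrCA ler_piMr ?(ltW e0)// ler_pdivrMr// mul1r.
  by rewrite lerDl.
apply: le_bayes_risk => // r Sr; rewrite dotZl ler_wpM2l//.
exact: bayes_risk_le.
Qed.

Lemma bayes_risk_superadditive (R : realType) (k : nat) (S : set 'rV[R]_k)
    (p q : 'rV[R]_k) :
  proper_risks S -> nonneg_orthant p -> nonneg_orthant q ->
  bayes_risk S p + bayes_risk S q <= bayes_risk S (p + q).
Proof.
move=> pS p0 q0; apply: le_bayes_risk => [|r Sr]; first by case: pS.
by rewrite dotDl lerD// bayes_risk_le.
Qed.

(** Superadditivity bounds the risk on a ray from below, a single nearly optimal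
    risk vector bounds it from above, and both bounds tend to the value at the
    origin of the ray. This is the continuity that recovers the boundary values
    of a risk from its values inside the orthant. *)
Lemma bayes_risk_ray_cvg (R : realType) (k : nat) (S : set 'rV[R]_k)
    (p q : 'rV[R]_k) (e : R) :
  proper_risks S -> nonneg_orthant p -> nonneg_orthant q -> 0 < e ->
  exists2 d : R, 0 < d & forall x, 0 < x -> x <= d ->
    `|bayes_risk S (p + x *: q) - bayes_risk S p| <= e.
Proof.
move=> pS p0 q0 e0.
have [r Sr lt] := bayes_risk_adherent pS p0 (divr_gt0 e0 (ltr0n _ 2)).
set M := 1 + `|dot q r| + `|bayes_risk S q|.
have M0 : 0 < M by rewrite /M -addrA ltr_wpDr.
exists (e / 2 / M) => [|x x0 xd]; first by rewrite !divr_gt0.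
have xM : x * M <= e / 2 by rewrite -ler_pdivlMr.
have xq0 : nonneg_orthant (x *: q) by apply: nonneg_orthantZ => //; exact: ltW.
have up := bayes_risk_le pS (nonneg_orthantD p0 xq0) Sr.
have lo := bayes_risk_superadditive pS p0 xq0.
rewrite bayes_riskZ ?(ltW x0)// in lo.
rewrite dotDl dotZl in up.
have xa : x * dot q r <= e / 2.
  apply: le_trans xM; rewrite ler_pM2l//; apply: (le_trans (ler_norm _)).
  by rewrite /M addrAC lerDr addr_ge0.
have xb : - (e / 2) <= x * bayes_risk S q.
  rewrite lerNl -mulrN; apply: le_trans xM; rewrite ler_pM2l//.
  apply: (le_trans (ler_norm _)); rewrite normrN.
  by rewrite /M lerDr addr_ge0.
by rewrite ler_norml; apply/andP; split; lra.
Qed.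

Lemma bayes_risk_bounded (R : realType) (k : nat) (S : set 'rV[R]_k) :
  proper_risks S ->
  exists M : R, forall p, simplex p -> `|bayes_risk S p| <= M.
Proof.
move=> pS; have [[r Sr] [m mS]] := pS.
exists (`|m| + \sum_y `|r 0 y|) => p [p0 p1].
have pc (c : R) : dot p (const_mx c) = c.
  by rewrite /dot -[RHS]mul1r -p1 mulr_suml; apply: eq_bigr => y _; rewrite mxE.
have sr0 : 0 <= \sum_y `|r 0 y| by rewrite sumr_ge0.
rewrite ler_norml; apply/andP; split.
  apply: (@le_trans _ _ m); first by move: (ler_norm (- m)); rewrite normrN; lra.
  apply: le_bayes_risk => [|s Ss]; first by exists r.
  by rewrite -[leLHS]pc; apply: ler_dotr => // y; rewrite mxE; exact: mS.
apply: (le_trans (bayes_risk_le pS p0 Sr)).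
apply: (@le_trans _ _ (\sum_y `|r 0 y|)); last by rewrite lerDr.
rewrite -[leRHS]pc; apply: ler_dotr => // y; rewrite mxE.
by apply: (le_trans (ler_norm _)); rewrite (bigD1 y)//= lerDl sumr_ge0.
Qed.


(** * Losses as sets of risk vectors *)

(** Actions with an infinite risk are left out: they give the weighted sum the
    value +oo for every vector of weights, zero weights included, and thus
    never influence an infimum over the actions. *)
Definition risk_vectors (R : realType) (k : nat) (L : loss R k) :
    set 'rV[R]_k :=
  [set r | exists al, forall y, L al y = (r 0 y)%:E].

Lemma weighted_sum_fin (R : realType) (k : nat) (L : loss R k)
    (al : 'rV[R]_k) (p r : 'rV[R]_k) :
  (forall y, L al y = (r 0 y)%:E) ->
  (\sum_(y < k) weighted (p 0%R y) (L al y))%E = (dot p r)%:E.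
Proof. by move=> Lr; rewrite /dot -sumEFin; apply: eq_bigr => y _; rewrite Lr. Qed.

Lemma weighted_sum_pinfty (R : realType) (k : nat) (L : loss R k)
    (al : 'rV[R]_k) (p : 'rV[R]_k) :
  bounded_below L ->
  ~ (exists r : 'rV[R]_k, forall y, L al y = (r 0 y)%:E) ->
  (\sum_(y < k) weighted (p 0%R y) (L al y))%E = +oo%E.
Proof.
move=> [m mL] nr.
have [y Ly] : exists y, L al y = +oo%E.
  apply: contrapT => nL; apply: nr; exists (\row_y fine (L al y)) => y.
  rewrite mxE fineK// fin_numElt (lt_le_trans (ltNyr m) (mL al y))/= ltey.
  by apply/eqP => Ly; apply: nL; exists y.
apply/eqP; rewrite esum_eqy; first by apply/existsP; exists y; rewrite /weighted Ly.
move=> j _; rewrite /weighted; case: ifPn => // Lj.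
by have := mL al j; case: (L al j) Lj => [l||]//=; rewrite -EFinM.
Qed.

Lemma proper_risk_vectors (R : realType) (k : nat) (L : loss R k)
    (p : 'rV[R]_k) :
  bounded_below L -> (entropy L p < +oo)%E -> proper_risks (risk_vectors L).
Proof.
move=> bL Hp; split; last first.
  have [m mL] := bL; exists m => r [al Lr] y.
  by have := mL al y; rewrite Lr lee_fin.
apply: contrapT => S0; move: Hp; apply/negP; rewrite -leNgt.
apply: le_ereal_inf_tmp => _ [al _ <-]; rewrite weighted_sum_pinfty// => -[r Lr].
by apply: S0; exists r, al.
Qed.

Lemma entropyE (R : realType) (k : nat) (L : loss R k) (p : 'rV[R]_k) :
  bounded_below L -> proper_risks (risk_vectors L) -> nonneg_orthant p ->
  entropy L p = (bayes_risk (risk_vectors L) p)%:E.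
Proof.
move=> bL pS p0; apply/eqP; rewrite eq_le; apply/andP; split.
  apply/lee_addgt0Pr => e e0.
  have [r [al Lr] lt] := bayes_risk_adherent pS p0 e0.
  apply: (@le_trans _ _ (dot p r)%:E); last by rewrite -EFinD lee_fin ltW.
  by apply: ereal_inf_lbound; exists al => //; exact: weighted_sum_fin.
apply: le_ereal_inf_tmp => _ [al _ <-].
have [[r Lr]|nr] := pselect (exists r : 'rV[R]_k, forall y, L al y = (r 0 y)%:E).
  by rewrite (weighted_sum_fin _ Lr) lee_fin; apply: bayes_risk_le => //; exists al.
by rewrite weighted_sum_pinfty// leey.
Qed.

(** The vector of class weights at which f_pi evaluates the entropy: likelihood
    ratios are taken relative to the last class, whose own ratio is 1. *)
Definition reweight (R : realType) (n : nat) (pi : 'rV[R]_n.+1)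
    (t : 'rV[R]_n) : 'rV[R]_n.+1 :=
  \row_y (pi 0 y * oapp (t 0) 1 (unlift ord_max y)).

Lemma unlift_widen (n : nat) (i : 'I_n) :
  unlift ord_max (widen_ord (leqnSn n) i) = Some i.
Proof.
have -> : widen_ord (leqnSn n) i = lift ord_max i.
  by apply: val_inj => /=; rewrite /bump leqNgt ltn_ord.
exact: liftK.
Qed.

Lemma reweight_widen (R : realType) (n : nat) (pi : 'rV[R]_n.+1)
    (t : 'rV[R]_n) (i : 'I_n) :
  reweight pi t 0 (widen_ord (leqnSn n) i) =
  pi 0 (widen_ord (leqnSn n) i) * t 0 i.
Proof. by rewrite mxE unlift_widen. Qed.

Lemma reweight_max (R : realType) (n : nat) (pi : 'rV[R]_n.+1)
    (t : 'rV[R]_n) :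
  reweight pi t 0 ord_max = pi 0 ord_max.
Proof. by rewrite mxE unlift_none mulr1. Qed.

Lemma nonneg_reweight (R : realType) (n : nat) (pi : 'rV[R]_n.+1)
    (t : 'rV[R]_n) :
  nonneg_orthant pi -> nonneg_orthant t -> nonneg_orthant (reweight pi t).
Proof.
by move=> p0 t0 y; rewrite mxE mulr_ge0//; case: unliftP => //= i _; exact: t0.
Qed.

(** Up to sign and a constant, f_pi is the entropy extended homogeneously from
    the simplex to the orthant: the supremum over the actions is the infimum
    that defines this extension. *)
Lemma f_piE (R : realType) (n : nat) (L : loss R n.+1) (pi : 'rV[R]_n.+1)
    (t : 'rV[R]_n) :
  bounded_below L -> proper_risks (risk_vectors L) -> nonneg_orthant pi ->
  nonneg_orthant t ->
  f_pi L pi t = (bayes_risk (risk_vectors L) pi -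
                 bayes_risk (risk_vectors L) (reweight pi t))%:E.
Proof.
move=> bL pS pi0 t0; set S := risk_vectors L.
have s0 := nonneg_reweight pi0 t0.
have valE al : (entropy L pi
      - (\sum_(i < n) weighted (pi 0%R (widen_ord (leqnSn n) i) * t 0%R i)%R
                               (L al (widen_ord (leqnSn n) i)))
      - weighted (pi 0%R ord_max) (L al ord_max) =
   (bayes_risk S pi)%:E -
      \sum_(y < n.+1) weighted (reweight pi t 0%R y) (L al y))%E.
  rewrite (entropyE bL pS pi0) -/S big_ord_recr/= reweight_max.
  under [in RHS]eq_bigr do rewrite reweight_widen.
  have wNy (w : R) (l : \bar R) : (l != -oo -> weighted w l != -oo)%E.
    by rewrite /weighted; case: ifPn => //; case: l.
  have LNy y : (L al y != -oo)%E.
    by have [m /(_ al y)] := bL; case: (L al y).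
  rewrite oppeD ?addeA// /adde_def (negbTE (wNy _ _ (LNy _))) andbF/=.
  rewrite negb_and; apply/orP; left.
  by apply/eqP => /esum_eqNyP[i [_ _ /eqP]]; apply/negP; exact: wNy.
rewrite /f_pi; under eq_imagel do rewrite valE.
apply/eqP; rewrite eq_le; apply/andP; split.
  apply: ge_ereal_sup => _ [al _ <-].
  have [[r Lr]|nr] := pselect (exists r : 'rV[R]_n.+1, forall y, L al y = (r 0 y)%:E).
    rewrite (weighted_sum_fin _ Lr) -EFinB lee_fin lerD2l lerN2.
    by apply: bayes_risk_le => //; exists al.
  by rewrite weighted_sum_pinfty// leNye.
apply/lee_addgt0Pr => e e0.
have [r [al Lr] lt] := bayes_risk_adherent pS s0 e0.
rewrite -leeBlDr//.
apply: (@le_trans _ _ (bayes_risk S pi - dot (reweight pi t) r)%:E).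
  by rewrite -EFinB lee_fin; rewrite -/S in lt *; lra.
apply: ereal_sup_ubound; exists al => //.
by rewrite (weighted_sum_fin _ Lr) -EFinB.
Qed.


(** * Affine relations on the cone of the prior *)

(** Posteriors take their values in this cone outside a null event. *)
Definition prior_cone (R : realType) (k : nat) (pi : 'rV[R]_k) :
    set 'rV[R]_k :=
  [set v | nonneg_orthant v /\ forall y, pi 0 y = 0 -> v 0 y = 0].

Definition affinely_related (R : realType) (k : nat) (pi : 'rV[R]_k)
    (S1 S2 : set 'rV[R]_k) : Prop :=
  exists (a : R) (c : 'rV[R]_k), 0 < a /\ forall v, prior_cone pi v ->
    bayes_risk S1 v = a * bayes_risk S2 v + dot v c.

Lemma prior_coneD (R : realType) (k : nat) (pi p q : 'rV[R]_k) :
  prior_cone pi p -> prior_cone pi q -> prior_cone pi (p + q).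
Proof.
move=> [p0 pp] [q0 pq]; split; first exact: nonneg_orthantD.
by move=> y py; rewrite mxE pp// pq// addr0.
Qed.

Lemma prior_coneZ (R : realType) (k : nat) (pi p : 'rV[R]_k) (a : R) :
  0 <= a -> prior_cone pi p -> prior_cone pi (a *: p).
Proof.
move=> a0 [p0 pp]; split; first exact: nonneg_orthantZ.
by move=> y py; rewrite mxE pp// mulr0.
Qed.

Lemma prior_cone0 (R : realType) (k : nat) (pi : 'rV[R]_k) :
  prior_cone pi 0.
Proof. by split=> y; rewrite mxE. Qed.

Lemma bayes_risk0 (R : realType) (k : nat) (S : set 'rV[R]_k) :
  proper_risks S -> bayes_risk S 0 = 0.
Proof.
move=> pS; rewrite -[in LHS](scale0r 0) bayes_riskZ ?mul0r//.
by move=> y; rewrite mxE.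
Qed.

(** If the last class has positive prior mass, every vector of the prior cone
    with a positive last coordinate has a multiple in the image of the
    reweighting map; otherwise the image is the whole cone (take x = 1). *)
Lemma reweight_rescale (R : realType) (n : nat) (pi v : 'rV[R]_n.+1) (x : R) :
  prior_cone pi v -> x * v 0 ord_max = pi 0 ord_max ->
  reweight pi (\row_i (x * v 0 (widen_ord (leqnSn n) i) /
                       pi 0 (widen_ord (leqnSn n) i))) = x *: v.
Proof.
move=> [_ pv] xv; apply/rowP => y; rewrite [RHS]mxE.
have [i ->|->] := unliftP ord_max y; last by rewrite reweight_max xv.
have <- : widen_ord (leqnSn n) i = lift ord_max i.
  by apply: val_inj => /=; rewrite /bump leqNgt ltn_ord.
rewrite reweight_widen mxE; set y' := widen_ord _ i.
have [py|py] := eqVneq (pi 0 y') 0; first by rewrite py pv// mul0r mulr0.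
by rewrite mulrC divfK.
Qed.

(** Homogeneity turns an inhomogeneous affine relation on the section described
    by t into a linear one on the cone over that section. The rest of the prior
    cone is the face where the last coordinate vanishes although the last class
    has positive prior mass; the relation extends to it by continuity along
    rays. *)
Lemma affinely_related_f (R : realType) (n : nat) (pi : 'rV[R]_n.+1)
    (S1 S2 : set 'rV[R]_n.+1) :
  proper_risks S1 -> proper_risks S2 -> nonneg_orthant pi ->
  affinely_related pi S1 S2 <->
  exists (a : R) (b : 'rV[R]_n) (c : R), 0 < a /\
    forall t, nonneg_orthant t ->
      bayes_risk S1 pi - bayes_risk S1 (reweight pi t) =
      a * (bayes_risk S2 pi - bayes_risk S2 (reweight pi t)) +
      (\sum_(i < n) b 0 i * t 0 i + c).
Proof.
move=> pS1 pS2 pi0; split.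
  move=> [a [c [a0 rel]]].
  exists a, (\row_i - (pi 0 (widen_ord (leqnSn n) i) *
                       c 0 (widen_ord (leqnSn n) i))),
    (bayes_risk S1 pi - a * bayes_risk S2 pi - pi 0 ord_max * c 0 ord_max).
  split=> // t t0.
  have /rel -> : prior_cone pi (reweight pi t).
    split; first exact: nonneg_reweight.
    by move=> y py; rewrite mxE py mul0r.
  rewrite /dot big_ord_recr/= reweight_max.
  under eq_bigr do rewrite reweight_widen.
  under [in RHS]eq_bigr do rewrite mxE mulNr mulrAC.
  rewrite sumrN; lra.
move=> [a [b [c [a0 rel]]]].
pose kappa := bayes_risk S1 pi - a * bayes_risk S2 pi - c.
pose G (v : 'rV[R]_n.+1) :=
  \sum_(i < n) b 0 i * v 0 (widen_ord (leqnSn n) i) /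
               pi 0 (widen_ord (leqnSn n) i).
have scaled v x : prior_cone pi v -> 0 < x -> x * v 0 ord_max = pi 0 ord_max ->
    bayes_risk S1 v = a * bayes_risk S2 v + kappa / x - G v.
  move=> Cv x0 xv; have [v0 _] := Cv.
  have := rel (\row_i (x * v 0 (widen_ord (leqnSn n) i) /
                       pi 0 (widen_ord (leqnSn n) i))).
  rewrite reweight_rescale// !bayes_riskZ ?(ltW x0)//.
  have -> : \sum_(i < n) b 0 i * (\row_i (x * v 0 (widen_ord (leqnSn n) i) /
       pi 0 (widen_ord (leqnSn n) i))) 0 i = x * G v.
    by rewrite /G mulr_sumr; apply: eq_bigr => i _; rewrite mxE; ring.
  move=> /(_ _)/wrap[|H]; first by move=> i; rewrite mxE divr_ge0// mulr_ge0// ltW.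
  apply: (mulfI (lt0r_neq0 x0)).
  rewrite !mulrDr [x * (kappa / x)]mulrCA divff ?lt0r_neq0// /kappa; lra.
(* homogenization: the constant kappa becomes the last coefficient *)
pose cr : 'rV[R]_n.+1 :=
  \row_y oapp (fun i => - (b 0 i / pi 0 y)) (kappa / pi 0 y) (unlift ord_max y).
have dotE v : dot v cr = v 0 ord_max * (kappa / pi 0 ord_max) - G v.
  rewrite /dot big_ord_recr/= addrC mxE unlift_none; congr (_ + _).
  rewrite /G -sumrN; apply: eq_bigr => i _; rewrite mxE unlift_widen/=; ring.
exists a, cr; split=> // v Cv; rewrite dotE addrA; have [v0 pv] := Cv.
have [pk|pk] := eqVneq (pi 0 ord_max) 0.
  (* the section contains the origin, where the relation reads kappa = 0 *)
  have kappa0 : kappa = 0.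
    have := scaled 0 1 (prior_cone0 pi) ltr01.
    rewrite !bayes_risk0// mxE mulr0 pk => /(_ erefl).
    rewrite /G big1 => [|i _]; last by rewrite mxE mulr0 mul0r.
    lra.
  rewrite (scaled v 1)// ?kappa0 ?pk ?pv//; lra.
have pk0 : 0 < pi 0 ord_max by rewrite lt_neqAle eq_sym pk pi0.
have inner w : prior_cone pi w -> 0 < w 0 ord_max ->
   bayes_risk S1 w =
     a * bayes_risk S2 w + w 0 ord_max * (kappa / pi 0 ord_max) - G w.
  move=> Cw wk; rewrite (scaled w (pi 0 ord_max / w 0 ord_max))//.
  - by rewrite invf_div; ring.
  - exact: divr_gt0.
  - by rewrite divfK// lt0r_neq0.
have [vk|vk] := eqVneq (v 0 ord_max) 0; last first.
  by apply: inner => //; rewrite lt_neqAle eq_sym vk v0.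
(* approach the face through the interior along the last coordinate axis *)
pose ek : 'rV[R]_n.+1 := delta_mx 0 ord_max.
have Cek : prior_cone pi ek.
  split; first exact: nonneg_orthant_delta.
  move=> y py; rewrite mxE eqxx /=; case: eqP => //= yk.
  by move: pk; rewrite -yk py eqxx.
have ek0 := proj1 Cek.
have rayE x : 0 < x -> bayes_risk S1 (v + x *: ek) =
    a * bayes_risk S2 (v + x *: ek) + x * (kappa / pi 0 ord_max) - G v.
  move=> x0; have xe : (v + x *: ek) 0 ord_max = x.
    by rewrite !mxE vk !eqxx mulr1 add0r.
  rewrite inner ?xe//; last exact/prior_coneD/prior_coneZ/Cek/ltW.
  congr (_ - _); apply: eq_bigr => i _; rewrite !mxE andTb.
  have -> : (widen_ord (leqnSn n) i == ord_max) = false.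
    by apply/negbTE; rewrite -val_eqE /= neq_ltn ltn_ord.
  by rewrite mulr0 addr0.
rewrite vk mul0r addr0; apply/eqP; rewrite -subr_eq0 -normr_le0.
apply/ler_addgt0Pr => e e0; rewrite add0r.
(* M and x are chosen so that the three error terms add up to at most e *)
pose M := 1 + a + `|kappa / pi 0 ord_max|.
have M0 : 0 < M by rewrite /M ltr_wpDr// addr_gt0.
have eM : 0 < e / M by rewrite divr_gt0.
have [d1 d10 H1] := bayes_risk_ray_cvg pS1 v0 ek0 eM.
have [d2 d20 H2] := bayes_risk_ray_cvg pS2 v0 ek0 eM.
pose x := Num.min (Num.min d1 d2) (e / M).
have x0 : 0 < x by rewrite !lt_min d10 d20.
have xd1 : x <= d1 by rewrite !ge_min lexx.
have xd2 : x <= d2 by rewrite !ge_min lexx orbT.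
have xe : x <= e / M by rewrite !ge_min lexx !orbT.
have {}H1 := H1 x x0 xd1; have {}H2 := H2 x x0 xd2.
have := rayE x x0; move: H1 H2; set A1 := bayes_risk S1 (_ + _).
set A2 := bayes_risk S2 (_ + _) => H1 H2 AE.
have -> : bayes_risk S1 v - (a * bayes_risk S2 v - G v) =
  a * (A2 - bayes_risk S2 v) - (A1 - bayes_risk S1 v) +
  x * (kappa / pi 0 ord_max) by rewrite AE; ring.
rewrite (le_trans (ler_normD _ _))//.
have -> : e = a * (e / M) + e / M + e / M * `|kappa / pi 0 ord_max|.
  have -> : a * (e / M) + e / M + e / M * `|kappa / pi 0 ord_max| = e / M * M.
    rewrite /M; ring.
  by rewrite divfK// lt0r_neq0.
rewrite lerD//; last first.
  by rewrite normrM (gtr0_norm x0) ler_wpM2r.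
rewrite (le_trans (ler_normB _ _))// lerD// normrM gtr0_norm// ler_wpM2l//.
exact: ltW.
Qed.


(** * Proportional merging gaps *)

(** The multiples of one nonzero value f z that bound f x determine the ratio
    f x / f z, which is therefore g x / g z as well; the multiple zero shows that
    f and g vanish together. *)
Lemma same_order_proportional (R : realType) (T : Type) (f g : T -> R) :
  (forall x, 0 <= f x) -> (forall x, 0 <= g x) ->
  (forall l x y, 0 <= l -> (f x <= l * f y) <-> (g x <= l * g y)) ->
  exists2 a, 0 < a & forall x, f x = a * g x.
Proof.
move=> f0 g0 fg.
have [[z gz]|ng] := pselect (exists z, 0 < g z); last first.
  exists 1 => // x; rewrite mul1r.
  have gx : g x = 0.
    apply/eqP; rewrite eq_le g0 leNgt andbT; apply/negP => gx.
    by apply: ng; exists x.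
  apply/eqP; rewrite gx eq_le f0 andbT.
  by have := @fg 0 x x (lexx 0); rewrite gx !mul0r => -[_]; exact.
have fz : 0 < f z.
  rewrite lt_neqAle f0 andbT eq_sym; apply/eqP => fz.
  have := @fg 0 z z (lexx 0); rewrite !mul0r fz => -[/(_ (lexx _)) + _].
  by rewrite leNgt gz.
exists (f z / g z) => [|x]; first exact: divr_gt0.
have H1 : g x <= f x / f z * g z.
  by apply/fg; rewrite ?divr_ge0// divfK ?lt0r_neq0.
have H2 : f x <= g x / g z * f z.
  by apply/fg; rewrite ?divr_ge0// divfK ?lt0r_neq0.
have -> : f z / g z * g x = g x / g z * f z by ring.
apply/eqP; rewrite eq_le H2/= mulrAC ler_pdivrMr//.
by move: H1; rewrite mulrAC ler_pdivlMr.
Qed.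

(** The information lost when two cells of joint masses u and v are merged into
    one. *)
Definition merging_gap (R : realType) (k : nat) (S : set 'rV[R]_k)
    (u v : 'rV[R]_k) : R :=
  bayes_risk S (u + v) - bayes_risk S u - bayes_risk S v.

(** If the gaps are proportional, the difference of the two risks is additive;
    together with positive homogeneity it is determined on the cone by its
    values on the coordinate axes. *)
Lemma proportional_gaps_affinely_related (R : realType) (k : nat)
    (pi : 'rV[R]_k) (S1 S2 : set 'rV[R]_k) (a : R) :
  proper_risks S1 -> proper_risks S2 -> 0 < a ->
  (forall u v, prior_cone pi u -> prior_cone pi v ->
    merging_gap S1 u v = a * merging_gap S2 u v) ->
  affinely_related pi S1 S2.
Proof.
move=> pS1 pS2 a0 gapE.
pose D p := bayes_risk S1 p - a * bayes_risk S2 p.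
have D0 : D 0 = 0 by rewrite /D !bayes_risk0// mulr0 subr0.
exists a, (\row_y D (delta_mx 0 y)); split=> // v Cv.
suff [_ DE] : prior_cone pi v /\ D v = dot v (\row_y D (delta_mx 0 y)).
  by rewrite -DE /D; ring.
rewrite /dot; under [X in _ /\ D v = X]eq_bigr do rewrite mxE.
have vE : \sum_y v 0 y *: delta_mx 0 y = v by rewrite -row_sum_delta.
rewrite -{1 2}vE.
apply: (big_ind2 (fun p x => prior_cone pi p /\ D p = x)) => /=.
- by split; [exact: prior_cone0|].
- move=> p x q y [Cp <-] [Cq <-]; split; first exact: prior_coneD.
  have := gapE p q Cp Cq; rewrite /merging_gap /D; lra.
- move=> y _; have [v0 pv] := Cv; split.
    split=> [|j pj]; first exact/nonneg_orthantZ/nonneg_orthant_delta.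
    rewrite !mxE eqxx/=; case: eqP => [<-|]; last by rewrite mulr0.
    by rewrite pv// mul0r.
  rewrite /D !bayes_riskZ//; [ring | exact: nonneg_orthant_delta..].
Qed.


(** * Quantizers of a finite experiment *)

Section discrete_probability.
Variables (R : realType) (N : nat) (w : nat -> R).
Hypotheses (w0 : forall j, 0 <= w j) (w1 : \sum_(j < N) w j = 1).

Definition discrete_probability : set nat -> \bar R :=
  msum (fun j => mscale (NngNum (w0 j)) (\d_j : measure nat R)) N.

HB.instance Definition _ := Measure.on discrete_probability.

Let discrete_probability_setT : discrete_probability [set: nat] = 1%E.
Proof.
rewrite /discrete_probability /msum/= /mscale/=.
by under eq_bigr do rewrite diracT mule1; rewrite sumEFin w1.
Qed.

HB.instance Definition _ :=
  Measure_isProbability.Build _ _ _ discrete_probability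
    discrete_probability_setT.

Lemma integral_discrete_probability (g : nat -> R) :
  (\int[discrete_probability]_x (g x)%:E = (\sum_(j < N) w j * g j)%R%:E)%E.
Proof.
have intE (f : nat -> R) : (forall x, 0 <= f x) ->
    (\int[discrete_probability]_x (f x)%:E = (\sum_(j < N) w j * f j)%R%:E)%E.
  move=> f0; rewrite ge0_integral_measure_sum//=; last first.
    by move=> x _; rewrite lee_fin.
  rewrite -sumEFin; apply: eq_bigr => i _.
  rewrite ge0_integral_mscale//=; last by move=> x _; rewrite lee_fin.
  by rewrite integral_dirac//= diracT mul1e.
have gp := intE (g^\+) (funrpos_ge0 g); have gn := intE (g^\-) (funrneg_ge0 g).
transitivity (\int[discrete_probability]_x ((g^\+)%R x)%:E -
              \int[discrete_probability]_x ((g^\-)%R x)%:E)%E.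
  rewrite integralE; congr (_ - _)%E; apply: eq_integral => x _.
    by rewrite -[LHS]/(((EFin \o g)^\+)%E x) funerpos.
  by rewrite -[LHS]/(((EFin \o g)^\-)%E x) funerneg.
rewrite gp gn -EFinB -sumrB; congr EFin; apply: eq_bigr => j _.
by rewrite -mulrBr -[in RHS](funrposBneg g).
Qed.

Lemma exists_discrete_probability : exists P : probability nat R,
  forall g : nat -> R,
    (\int[P]_x (g x)%:E = (\sum_(j < N) w j * g j)%R%:E)%E.
Proof. exists discrete_probability; exact: integral_discrete_probability. Qed.

End discrete_probability.

(** Here v j lists the joint masses of Y and the event X = j. A class of null
    prior mass has no conditional law, and an arbitrary one is chosen. *)
Lemma exists_experiment (R : realType) (k N : nat) (pi : 'rV[R]_k)
    (v : nat -> 'rV[R]_k) :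
  (forall j, prior_cone pi (v j)) -> \sum_(j < N) v j = pi ->
  exists P : 'I_k -> probability nat R, forall h : 'I_k -> nat -> R,
    (joint_expectation pi P (fun y x => (h y x)%:E) =
     (\sum_(j < N) \sum_y v j 0 y * h y j)%R%:E)%E.
Proof.
move=> Cv vpi.
have piE y : \sum_(j < N) v j 0 y = pi 0 y by rewrite -vpi summxE.
have /choice[P PE] : forall y, exists P : probability nat R,
    forall g : nat -> R, ((pi 0%R y)%:E * \int[P]_x (g x)%:E =
                          (\sum_(j < N) v j 0 y * g j)%R%:E)%E.
  move=> y; have [py|py] := eqVneq (pi 0 y) 0.
    exists (\d_0%N : probability nat R) => g; rewrite py mul0e big1// => j _.
    by rewrite (proj2 (Cv j))// mul0r.
  have w0 j : 0 <= v j 0 y / pi 0 y.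
    by rewrite divr_ge0// -?piE ?sumr_ge0// => *; exact: (proj1 (Cv _)).
  have w1 : \sum_(j < N) v j 0 y / pi 0 y = 1.
    by rewrite -mulr_suml piE divff.
  have [P PE] := exists_discrete_probability w0 w1.
  exists P => g; rewrite PE -EFinM; congr EFin.
  by rewrite mulr_sumr; apply: eq_bigr => j _; rewrite mulrA mulrCA divff ?mulr1.
exists P => h; rewrite /joint_expectation.
by under eq_bigr do rewrite PE; rewrite sumEFin exchange_big.
Qed.

Lemma sum_fibers (V : nmodType) (N : nat) (q : nat -> nat)
    (F : nat -> nat -> V) :
  (forall j, (q j < N)%N) ->
  \sum_(j < N) F (q j) j = \sum_(z < N) \sum_(j < N | q j == z) F z j.
Proof.
move=> qN; rewrite (partition_big (fun j : 'I_N => Ordinal (qN j)) xpredT)//=.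
by apply: eq_bigr => z _; apply: eq_bigr => j /eqP <-.
Qed.

Definition cell (R : realType) (k N : nat) (v : nat -> 'rV[R]_k)
  (q : nat -> nat) (z : nat) : 'rV[R]_k := \sum_(j < N | q j == z) v j.

(** On a cell of null mass the posterior is arbitrary; the prior is used. *)
Definition normalize (R : realType) (k : nat) (pi p : 'rV[R]_k) : 'rV[R]_k :=
  if \sum_y p 0 y == 0 then pi else (\sum_y p 0 y)^-1 *: p.

Lemma sum_scale_normalize (R : realType) (k : nat) (pi p : 'rV[R]_k) :
  nonneg_orthant p -> (\sum_y p 0 y) *: normalize pi p = p.
Proof.
move=> p0; rewrite /normalize; case: eqVneq => [s0|s0].
  rewrite s0 scale0r; apply/rowP => y; rewrite mxE; apply/esym/eqP.
  by move: s0 => /eqP; rewrite psumr_eq0// => /allP/(_ y); rewrite mem_index_enum; apply.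
by rewrite scalerA divff// scale1r.
Qed.

Lemma simplex_normalize (R : realType) (k : nat) (pi p : 'rV[R]_k) :
  simplex pi -> nonneg_orthant p -> simplex (normalize pi p).
Proof.
move=> spi p0; rewrite /normalize; case: eqVneq => // s0; split.
  by move=> y; rewrite mxE mulr_ge0// invr_ge0 sumr_ge0.
by under eq_bigr do rewrite mxE; rewrite -mulr_sumr mulVf.
Qed.

Section experiment.
Variables (R : realType) (k N : nat) (pi : 'rV[R]_k) (v : nat -> 'rV[R]_k).
Variables (P : 'I_k -> probability nat R) (q : nat -> nat).
Hypotheses (pi_simplex : simplex pi) (Cv : forall j, prior_cone pi (v j)).
Hypothesis PE : forall h : 'I_k -> nat -> R,
  (joint_expectation pi P (fun y x => (h y x)%:E) =
     (\sum_(j < N) \sum_y v j 0 y * h y j)%R%:E)%E.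
Hypothesis qN : forall j, (q j < N)%N.

Lemma prior_cone_cell z : prior_cone pi (cell N v q z).
Proof.
rewrite /cell; apply: big_ind => //; first exact: prior_cone0.
by move=> *; exact: prior_coneD.
Qed.

Lemma joint_expectation_quantized (g : nat -> R) :
  joint_expectation pi P (fun _ x => (g (q x))%:E) =
  (\sum_(z < N) (\sum_y cell N v q z 0 y) * g z)%:E.
Proof.
rewrite PE; congr EFin.
under eq_bigr do rewrite -mulr_suml.
rewrite (@sum_fibers _ N q (fun z j => (\sum_y v j 0 y) * g z))//.
apply: eq_bigr => z _; rewrite -mulr_suml; congr (_ * _).
by rewrite exchange_big; apply: eq_bigr => y _; rewrite /cell summxE.
Qed.

Let post z := normalize pi (cell N v q z).

Lemma is_posterior_normalize : is_posterior pi P q post.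
Proof.
split=> // [z|y B _].
  exact/simplex_normalize/(proj1 (prior_cone_cell z)).
rewrite (joint_expectation_quantized (fun z => post z 0 y * \1_B z)).
rewrite PE; congr EFin.
transitivity (\sum_(j < N) v j 0 y * \1_B (q j)); last first.
  apply: eq_bigr => j _; rewrite (bigD1 y)//= eqxx mul1r big1 ?addr0// => y' yy.
  by rewrite (negbTE yy) mul0r mulr0.
rewrite (@sum_fibers _ N q (fun z j => v j 0 y * \1_B z))//.
apply: eq_bigr => z _; rewrite -mulr_suml mulrA; congr (_ * _).
have := sum_scale_normalize pi (proj1 (prior_cone_cell z)).
by move=> /rowP/(_ y); rewrite mxE => ->; rewrite /cell summxE.
Qed.

(** A cell contributes its total mass times the risk of its normalization, which
    by homogeneity is the risk of its vector of joint masses. *)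
Lemma information_cells (L : loss R k) :
  bounded_below L -> proper_risks (risk_vectors L) ->
  information pi P (entropy L) q post =
  (bayes_risk (risk_vectors L) pi -
   \sum_(z < N) bayes_risk (risk_vectors L) (cell N v q z))%:E.
Proof.
move=> bL pS; have [spost _ _] := is_posterior_normalize.
rewrite /information entropyE//; last by case: pi_simplex.
have -> : (fun (_ : 'I_k) x => entropy L (post (q x))) =
    (fun _ x => (bayes_risk (risk_vectors L) (post (q x)))%:E).
  by apply/funext => y; apply/funext => x; rewrite entropyE//; case: (spost (q x)).
rewrite (joint_expectation_quantized (fun z => bayes_risk _ (post z))) -EFinB.
congr (EFin (_ - _)); apply: eq_bigr => z _.
have c0 := proj1 (prior_cone_cell z).
rewrite -bayes_riskZ ?sum_scale_normalize//; last by case: (spost z).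
by rewrite sumr_ge0.
Qed.

End experiment.

Lemma universally_equivalent_cells (R : realType) (k N : nat) (pi : 'rV[R]_k)
    (L1 L2 : loss R k) (v : nat -> 'rV[R]_k) (q1 q2 : nat -> nat) :
  simplex pi -> bounded_below L1 -> bounded_below L2 ->
  proper_risks (risk_vectors L1) -> proper_risks (risk_vectors L2) ->
  universally_equivalent pi L1 L2 ->
  (forall j, prior_cone pi (v j)) -> \sum_(j < N) v j = pi ->
  (forall j, (q1 j < N)%N) -> (forall j, (q2 j < N)%N) ->
  let value L q := \sum_(z < N) bayes_risk (risk_vectors L) (cell N v q z) in
  value L1 q1 <= value L1 q2 <-> value L2 q1 <= value L2 q2.
Proof.
move=> spi bL1 bL2 pS1 pS2 UE Cv vpi q1N q2N value.
have [P PE] := exists_experiment Cv vpi.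
have post1 := is_posterior_normalize spi Cv PE q1N.
have post2 := is_posterior_normalize spi Cv PE q2N.
have mq (q : nat -> nat) : measurable_fun [set: nat] q by [].
have := UE _ _ _ _ _ _ P q2 q1 _ _ (mq q2) (mq q1) post2 post1.
by rewrite !information_cells// !lee_fin !lerD2l !lerN2.
Qed.


(** * Necessity of the affine relation *)

Lemma merging_gap_ge0 (R : realType) (k : nat) (S : set 'rV[R]_k)
    (u v : 'rV[R]_k) :
  proper_risks S -> nonneg_orthant u -> nonneg_orthant v ->
  0 <= merging_gap S u v.
Proof.
move=> pS u0 v0; have := bayes_risk_superadditive pS u0 v0.
by rewrite /merging_gap; lra.
Qed.

Lemma merging_gapZ (R : realType) (k : nat) (S : set 'rV[R]_k) (l : R)
    (u v : 'rV[R]_k) :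
  proper_risks S -> 0 <= l -> nonneg_orthant u -> nonneg_orthant v ->
  merging_gap S (l *: u) (l *: v) = l * merging_gap S u v.
Proof.
move=> pS l0 u0 v0; rewrite /merging_gap -scalerDr !bayes_riskZ//; first by ring.
exact: nonneg_orthantD.
Qed.

(** The constant is explicit: with the total of the likelihood ratios of w
    against pi in the denominator, every coordinate fits under the prior. *)
Lemma prior_cone_fits (R : realType) (k : nat) (pi w : 'rV[R]_k) :
  nonneg_orthant pi -> prior_cone pi w ->
  exists2 e : R, 0 < e & prior_cone pi (pi - e *: w).
Proof.
move=> pi0 [w0 pw]; pose s := 1 + \sum_y w 0 y / pi 0 y.
have r0 y : 0 <= w 0 y / pi 0 y by rewrite divr_ge0.
have s0 : 0 < s by rewrite /s ltr_wpDr// sumr_ge0.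
exists s^-1; first by rewrite invr_gt0.
split=> y; last by move=> py; rewrite !mxE pw// py mulr0 subrr.
rewrite !mxE subr_ge0; have [py|py] := eqVneq (pi 0 y) 0.
  by rewrite pw// mulr0.
have py0 : 0 < pi 0 y by rewrite lt_neqAle eq_sym py pi0.
rewrite mulrC ler_pdivrMr// mulrC -ler_pdivrMr//.
by rewrite /s (bigD1 y)//= addrCA lerDl addr_ge0// sumr_ge0.
Qed.

(** Scale the four vectors so that they fit under the prior, and let them, with
    the remainder, be the joint masses of an experiment with five outcomes.
    One quantizer merges u with v and keeps u' and v' apart, another one does
    the opposite; relative to the identity they lose the two scaled gaps, so
    comparing their informations compares the gaps. *)
Lemma universally_equivalent_gaps (R : realType) (k : nat) (pi : 'rV[R]_k)
    (L1 L2 : loss R k) (u v u' v' : 'rV[R]_k) :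
  simplex pi -> bounded_below L1 -> bounded_below L2 ->
  proper_risks (risk_vectors L1) -> proper_risks (risk_vectors L2) ->
  universally_equivalent pi L1 L2 ->
  prior_cone pi u -> prior_cone pi v ->
  prior_cone pi u' -> prior_cone pi v' ->
  merging_gap (risk_vectors L1) u v <= merging_gap (risk_vectors L1) u' v' <->
  merging_gap (risk_vectors L2) u v <= merging_gap (risk_vectors L2) u' v'.
Proof.
move=> spi bL1 bL2 pS1 pS2 UE Cu Cv Cu' Cv'.
have [e e0 Crest] := prior_cone_fits (proj1 spi)
  (prior_coneD (prior_coneD Cu Cv) (prior_coneD Cu' Cv')).
set rest := pi - _ in Crest.
have CZ w : prior_cone pi w -> prior_cone pi (e *: w).
  by apply: prior_coneZ; exact: ltW.
pose cells := [:: e *: u; e *: v; e *: u'; e *: v'; rest].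
(* four cells are in use; the fifth one is empty and has risk zero *)
pose q1 := nth 0%N [:: 0; 0; 1; 2; 3]%N.
pose q2 := nth 0%N [:: 0; 1; 2; 2; 3]%N.
have valueE L : proper_risks (risk_vectors L) ->
  (\sum_(z < 5) bayes_risk (risk_vectors L) (cell 5 (nth 0 cells) q1 z) <=
   \sum_(z < 5) bayes_risk (risk_vectors L) (cell 5 (nth 0 cells) q2 z)) =
  (merging_gap (risk_vectors L) u v <= merging_gap (risk_vectors L) u' v').
  move=> pS; rewrite -[RHS](ler_pM2l e0).
  rewrite -!(merging_gapZ pS (ltW e0)); try by case: Cu Cv Cu' Cv' => ? _ [? _] [? _] [].
  have cellE q z : cell 5 (nth 0 cells) q z =
      (if q 0 == z then e *: u else 0) + ((if q 1 == z then e *: v else 0) +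
      ((if q 2 == z then e *: u' else 0) + ((if q 3 == z then e *: v' else 0) +
      (if q 4 == z then rest else 0)))).
    by rewrite /cell big_mkcond !big_ord_recl big_ord0 /= addr0.
  rewrite /merging_gap !big_ord_recl !big_ord0 /= !cellE /q1 /q2 /= !(addr0, add0r).
  by rewrite bayes_risk0//; apply/idP/idP; lra.
rewrite -!valueE//; apply: (universally_equivalent_cells spi) => //.
- move=> [|[|[|[|[|j]]]]] /=; [exact: CZ..| exact: Crest |].
  by rewrite nth_nil; exact: prior_cone0.
- rewrite !big_ord_recl big_ord0 /= addr0 /rest !scalerDr.
  by rewrite !addrA addrAC subrr add0r.
- by move=> [|[|[|[|[|j]]]]] //=; rewrite /q1 /= nth_nil.
- by move=> [|[|[|[|[|j]]]]] //=; rewrite /q2 /= nth_nil.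
Qed.

(** Gaps are positively homogeneous, so comparing all pairs of gaps also compares
    one gap with all nonnegative multiples of another, which forces the gaps of
    the two losses to be proportional. *)
Lemma universally_equivalent_affinely_related (R : realType) (k : nat)
    (pi : 'rV[R]_k) (L1 L2 : loss R k) :
  simplex pi -> bounded_below L1 -> bounded_below L2 ->
  proper_risks (risk_vectors L1) -> proper_risks (risk_vectors L2) ->
  universally_equivalent pi L1 L2 ->
  affinely_related pi (risk_vectors L1) (risk_vectors L2).
Proof.
move=> spi bL1 bL2 pS1 pS2 UE.
pose T := {uv : 'rV[R]_k * 'rV[R]_k | prior_cone pi uv.1 /\ prior_cone pi uv.2}.
pose gap S (x : T) := merging_gap S (sval x).1 (sval x).2.
have gap0 S : proper_risks S -> forall x, 0 <= gap S x.
  by move=> pS x; have [[u0 _] [v0 _]] := svalP x; exact: merging_gap_ge0.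
have [|a a0 gapE] :=
  same_order_proportional (gap0 _ pS1) (gap0 _ pS2).
  move=> l x y l0; have [Cu Cv] := svalP x; have [Cu' Cv'] := svalP y.
  have [u0 _] := Cu'; have [v0 _] := Cv'.
  rewrite /gap -!merging_gapZ//.
  by apply: (universally_equivalent_gaps spi) => //; exact: prior_coneZ.
apply: (proportional_gaps_affinely_related pS1 pS2 a0) => u v Cu Cv.
exact: (gapE (exist _ (u, v) (conj Cu Cv))).
Qed.


(** * Sufficiency of the affine relation *)

(** The infimum over the actions is uncountable, but on the orthant only upper
    bounds on the risks matter: rational vectors that dominate some risk
    vector give the same infimum. *)
Lemma bayes_risk_ltP (R : realType) (k : nat) (S : set 'rV[R]_k)
    (p : 'rV[R]_k) (x : R) :
  proper_risks S -> simplex p ->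
  bayes_risk S p < x <->
  exists r : 'rV[rat]_k,
    (exists2 s, S s & forall y, s 0 y <= ratr (r 0 y)) /\
    dot p (map_mx ratr r) < x.
Proof.
move=> pS [p0 p1]; split=> [lt|[r [[s Ss sr] lt]]]; last first.
  apply: le_lt_trans lt; apply: (le_trans (bayes_risk_le pS p0 Ss)).
  by apply: ler_dotr => // y; rewrite mxE.
have e0 : 0 < x - bayes_risk S p by rewrite subr_gt0.
have [s Ss lts] := bayes_risk_adherent pS p0 e0.
have d0 : 0 < (x - dot p s) / 2 by rewrite divr_gt0// subr_gt0; lra.
set e := (x - dot p s) / 2 in d0.
have /choice[r rP] : forall y, exists q : rat,
    ratr q \in `]s 0 y, s 0 y + e[.
  by move=> y; apply: rat_in_itvoo; rewrite ltrDl.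
exists (\row_y r y); split.
  by exists s => // y; rewrite mxE; have := rP y; rewrite in_itv/= => /andP[/ltW].
apply: (@le_lt_trans _ _ (dot p s + e)); last by rewrite /e; lra.
rewrite -[X in _ + X]mul1r -p1 /dot mulr_suml -big_split; apply: ler_sum => y _.
rewrite /= -mulrDr !mxE ler_wpM2l//.
by have := rP y; rewrite in_itv/= => /andP[_ /ltW].
Qed.

Lemma measurable_dot (R : realType) (k : nat) (d : measure_display)
    (X : measurableType d) (f : X -> 'rV[R]_k) (c : 'rV[R]_k) :
  (forall y, measurable_fun [set: X] (fun x => f x 0 y)) ->
  measurable_fun [set: X] (fun x => dot (f x) c).
Proof.
move=> mf; apply: measurable_sum => y; apply: measurable_funM => //.
Qed.

Lemma measurable_bayes_risk (R : realType) (k : nat) (d : measure_display)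
    (X : measurableType d) (S : set 'rV[R]_k) (f : X -> 'rV[R]_k) :
  proper_risks S -> (forall x, simplex (f x)) ->
  (forall y, measurable_fun [set: X] (fun x => f x 0 y)) ->
  measurable_fun [set: X] (fun x => bayes_risk S (f x)).
Proof.
move=> pS sf mf; apply: (measurability _ (RGenInftyO.measurableE R)).
move=> _ [_ [x ->] <-]; rewrite setTI.
pose A (r : 'rV[rat]_k) : set X :=
  [set _ | exists2 s, S s & forall y, s 0 y <= ratr (r 0 y)] `&`
  (fun z => dot (f z) (map_mx ratr r)) @^-1` `]-oo, x[.
rewrite (_ : _ @^-1` _ = \bigcup_r A r).
  apply: countable_bigcupT_measurable => [|r]; first exact: countableP.
  apply: measurableI; last first.
    by rewrite -[X in measurable X]setTI; exact: measurable_dot.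
  have [rS|rS] := pselect (exists2 s, S s & forall y, s 0 y <= ratr (r 0 y)).
    by rewrite (_ : [set _ | _] = setT)//; apply/seteqP; split.
  by rewrite (_ : [set _ | _] = set0)//; apply/seteqP; split.
apply/seteqP; split=> z /=.
  rewrite in_itv/= => /(bayes_risk_ltP _ pS (sf z))[r [rS lt]].
  by exists r => //; split=> //=; rewrite in_itv.
move=> [r _ [rS]]; rewrite /= !in_itv/= => lt.
by apply/(bayes_risk_ltP _ pS (sf z)); exists r.
Qed.

Definition bounded_measurable (R : realType) (d : measure_display)
    (X : measurableType d) (g : X -> R) : Prop :=
  measurable_fun [set: X] g /\ exists M, forall x, `|g x| <= M.

Lemma bounded_measurable_integrable (R : realType) (d : measure_display)
    (X : measurableType d) (P : probability X R) (g : X -> R) :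
  bounded_measurable g -> P.-integrable [set: X] (EFin \o g).
Proof.
move=> [mg [M gM]]; apply: measurable_bounded_integrable => //.
  by apply: (le_lt_trans (probability_le1 P measurableT)); exact: ltry.
exists M; split; first exact: num_real.
by move=> x Mx z _ /=; rewrite (le_trans (gM z))// ltW.
Qed.

Lemma bounded_measurableD (R : realType) (d : measure_display)
    (X : measurableType d) (g h : X -> R) :
  bounded_measurable g -> bounded_measurable h ->
  bounded_measurable (fun x => g x + h x).
Proof.
move=> [mg [M gM]] [mh [N hN]]; split; first exact: measurable_funD.
by exists (M + N) => x; rewrite (le_trans (ler_normD _ _))// lerD.
Qed.

Lemma bounded_measurableZ (R : realType) (d : measure_display)
    (X : measurableType d) (a : R) (g : X -> R) :
  bounded_measurable g -> bounded_measurable (fun x => a * g x).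
Proof.
move=> [mg [M gM]]; split; first exact: measurable_funM.
by exists (`|a| * M) => x; rewrite normrM ler_wpM2l.
Qed.

Lemma bounded_measurable_simplex (R : realType) (k : nat)
    (d : measure_display) (X : measurableType d) (f : X -> 'rV[R]_k) (y : 'I_k) :
  (forall x, simplex (f x)) ->
  (forall y, measurable_fun [set: X] (fun x => f x 0 y)) ->
  bounded_measurable (fun x => f x 0 y).
Proof.
move=> sf mf; split=> //; exists 1 => x; have [f0 f1] := sf x.
by rewrite ger0_norm// -f1 (bigD1 y)//= lerDl sumr_ge0.
Qed.

Lemma bounded_measurable_sum (R : realType) (I : Type) (s : seq I)
    (d : measure_display) (X : measurableType d) (g : I -> X -> R) :
  (forall i, bounded_measurable (g i)) ->
  bounded_measurable (fun x => \sum_(i <- s) g i x).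
Proof.
move=> bg; split; first by apply: measurable_sum => i; case: (bg i).
have /choice[M gM] : forall i, exists M, forall x, `|g i x| <= M.
  by move=> i; case: (bg i).
exists (\sum_(i <- s) M i) => x; rewrite (le_trans (ler_norm_sum _ _ _))//.
exact: ler_sum.
Qed.

Definition mean (R : realType) (k : nat) (d : measure_display)
    (X : measurableType d) (pi : 'rV[R]_k) (P : 'I_k -> probability X R)
    (g : X -> R) : R :=
  \sum_(y < k) pi 0 y * \int[P y]_x g x.

Lemma joint_expectation_mean (R : realType) (k : nat) (d : measure_display)
    (X : measurableType d) (pi : 'rV[R]_k) (P : 'I_k -> probability X R)
    (g : X -> R) :
  bounded_measurable g ->
  joint_expectation pi P (fun _ x => (g x)%:E) = (mean pi P g)%:E.
Proof.
move=> bg; rewrite /joint_expectation /mean -sumEFin; apply: eq_bigr => y _.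
rewrite EFinM; congr (_ * _)%E; rewrite fineK//.
exact/integrable_fin_num/bounded_measurable_integrable.
Qed.

Lemma meanD (R : realType) (k : nat) (d : measure_display)
    (X : measurableType d) (pi : 'rV[R]_k) (P : 'I_k -> probability X R)
    (g h : X -> R) :
  bounded_measurable g -> bounded_measurable h ->
  mean pi P (fun x => g x + h x) = mean pi P g + mean pi P h.
Proof.
move=> bg bh; rewrite /mean -big_split; apply: eq_bigr => y _.
rewrite RintegralD//=; [|exact: bounded_measurable_integrable..].
by rewrite mulrDr.
Qed.

Lemma meanZ (R : realType) (k : nat) (d : measure_display)
    (X : measurableType d) (pi : 'rV[R]_k) (P : 'I_k -> probability X R)
    (a : R) (g : X -> R) :
  bounded_measurable g ->
  mean pi P (fun x => a * g x) = a * mean pi P g.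
Proof.
move=> bg; rewrite /mean mulr_sumr; apply: eq_bigr => y _.
rewrite RintegralZl//; last exact: bounded_measurable_integrable.
by rewrite mulrCA.
Qed.

Lemma mean_sum (R : realType) (k : nat) (d : measure_display)
    (X : measurableType d) (pi : 'rV[R]_k) (P : 'I_k -> probability X R)
    (I : Type) (s : seq I) (g : I -> X -> R) :
  (forall i, bounded_measurable (g i)) ->
  mean pi P (fun x => \sum_(i <- s) g i x) = \sum_(i <- s) mean pi P (g i).
Proof.
move=> bg; elim: s => [|i s IH].
  rewrite big_nil /mean big1// => y _.
  under eq_Rintegral do rewrite big_nil.
  by rewrite /Rintegral integral0 mulr0.
rewrite big_cons -IH -meanD//; last exact: bounded_measurable_sum.
by congr mean; apply/funext => x; rewrite big_cons.
Qed.

Lemma mean_ae (R : realType) (k : nat) (d : measure_display)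
    (X : measurableType d) (pi : 'rV[R]_k) (P : 'I_k -> probability X R)
    (g h : X -> R) :
  bounded_measurable g -> bounded_measurable h ->
  (forall y, pi 0 y != 0 -> {ae P y, forall x, g x = h x}) ->
  mean pi P g = mean pi P h.
Proof.
move=> [mg _] [mh _] gh; apply: eq_bigr => y _.
have [->|py] := eqVneq (pi 0 y) 0; first by rewrite !mul0r.
congr (_ * fine _); apply: ae_eq_integral => //.
- exact/measurable_EFinP.
- exact/measurable_EFinP.
- by apply: filterS (gh y py) => x ghx _; rewrite /= ghx.
Qed.

Section posterior.
Variables (R : realType) (k : nat) (d d' : measure_display).
Variables (X : measurableType d) (Z : measurableType d').
Variables (pi : 'rV[R]_k) (P : 'I_k -> probability X R).
Variables (q : X -> Z) (post : Z -> 'rV[R]_k).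
Hypotheses (pi_simplex : simplex pi) (mq : measurable_fun [set: X] q).
Hypothesis postP : is_posterior pi P q post.

Lemma measurable_posterior y :
  measurable_fun [set: X] (fun x => post (q x) 0 y).
Proof.
have [_ mpost _] := postP.
exact: (@measurableT_comp _ _ _ _ _ _ (fun z => post z 0 y)).
Qed.

Let simplex_posterior x : simplex (post (q x)).
Proof. by case: postP. Qed.

Lemma mean_posterior y : mean pi P (fun x => post (q x) 0 y) = pi 0 y.
Proof.
have bp := bounded_measurable_simplex y simplex_posterior measurable_posterior.
have [_ _ /(_ y setT measurableT)] := postP.
under eq_fun do under eq_fun do rewrite indicT mulr1.
rewrite joint_expectation_mean// /joint_expectation => H.
apply: EFin_inj; rewrite H (bigD1 y)//= big1 => [|j jy].
  rewrite adde0 eqxx; under eq_integral do rewrite indicT mulr1.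
  rewrite integral_cst// mul1e -[RHS]mule1; congr (_ * _)%E.
  exact: (probability_setT (P y)).
under eq_integral do rewrite (negbTE jy) mul0r.
by rewrite integral0 mule0.
Qed.

(** The posterior mass of a class is nonnegative with mean the prior mass, so it
    vanishes almost surely when the prior mass is zero. *)
Lemma posterior_prior_cone_ae y : pi 0 y != 0 ->
  {ae P y, forall x, prior_cone pi (post (q x))}.
Proof.
move=> py.
have H (j : 'I_k) : {ae P y, forall x, pi 0 j = 0 -> post (q x) 0 j = 0}.
  have [pj|pj] := eqVneq (pi 0 j) 0; last first.
    by apply: aeW => x pj0; rewrite pj0 eqxx in pj.
  have bp := bounded_measurable_simplex j simplex_posterior measurable_posterior.
  have p0 x : (0 <= (post (q x) 0 j)%:E)%E.
    by rewrite lee_fin; case: (simplex_posterior x).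
  have [pi0 _] := pi_simplex.
  have := mean_posterior j; rewrite pj => /eqP.
  rewrite psumr_eq0; last first.
    by move=> i _; rewrite mulr_ge0// fine_ge0// integral_ge0.
  move=> /allP/(_ y); rewrite mem_index_enum mulf_eq0 (negbTE py) => /(_ isT)/= I0.
  have I0' : (\int[P y]_x `|(post (q x) 0%R j)%:E| = 0)%E.
    under eq_integral do rewrite gee0_abs//.
    rewrite -[LHS]fineK; first by rewrite -[fine _]/(Rintegral _ _ _) (eqP I0).
    exact/integrable_fin_num/bounded_measurable_integrable.
  have : ae_eq (P y) setT (fun x => (post (q x) 0 j)%:E) (cst 0%E).
    by apply/ae_eq_integral_abs => //; apply/measurable_EFinP; case: bp.
  by apply: filterS => x /(_ I) /= [->].
have : {ae P y, forall x, forall j, pi 0 j = 0 -> post (q x) 0 j = 0}.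
  exact: filter_forall.
apply: filterS => x Hx; split=> //.
by case: (simplex_posterior x).
Qed.

Lemma informationE (L : loss R k) :
  bounded_below L -> proper_risks (risk_vectors L) ->
  information pi P (entropy L) q post =
  (bayes_risk (risk_vectors L) pi -
   mean pi P (fun x => bayes_risk (risk_vectors L) (post (q x))))%:E.
Proof.
move=> bL pS; rewrite /information entropyE//; last by case: pi_simplex.
have -> : (fun (_ : 'I_k) x => entropy L (post (q x))) =
    (fun _ x => (bayes_risk (risk_vectors L) (post (q x)))%:E).
  apply/funext => y; apply/funext => x; rewrite entropyE//.
  by case: (simplex_posterior x).
rewrite joint_expectation_mean//; split.
  exact: (measurable_bayes_risk pS simplex_posterior measurable_posterior).
by have [M HM] := bayes_risk_bounded pS; exists M => x; exact: HM.
Qed.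

(** Posteriors have mean pi whatever the quantizer, so the linear part of the
    relation contributes a constant that cancels in comparisons. *)
Lemma mean_affinely_related (S1 S2 : set 'rV[R]_k) (a : R) (c : 'rV[R]_k) :
  proper_risks S1 -> proper_risks S2 ->
  (forall v, prior_cone pi v ->
    bayes_risk S1 v = a * bayes_risk S2 v + dot v c) ->
  mean pi P (fun x => bayes_risk S1 (post (q x))) =
  a * mean pi P (fun x => bayes_risk S2 (post (q x))) + dot pi c.
Proof.
move=> pS1 pS2 rel.
have bm S : proper_risks S ->
    bounded_measurable (fun x => bayes_risk S (post (q x))).
  move=> pS; split.
    exact: (measurable_bayes_risk pS simplex_posterior measurable_posterior).
  by have [M HM] := bayes_risk_bounded pS; exists M => x; exact: HM.
have bp y : bounded_measurable (fun x => c 0 y * post (q x) 0 y).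
  apply: bounded_measurableZ.
  exact: bounded_measurable_simplex simplex_posterior measurable_posterior.
pose h x := \sum_y c 0 y * post (q x) 0 y.
have bh : bounded_measurable h by exact: bounded_measurable_sum.
have ba := bounded_measurableZ a (bm _ pS2).
rewrite (@mean_ae _ _ _ _ _ _ _
  (fun x => a * bayes_risk S2 (post (q x)) + h x)); first last.
- move=> y py; apply: filterS (posterior_prior_cone_ae py) => x /rel ->.
  by congr (_ + _); apply: eq_bigr => j _; rewrite mulrC.
- exact: bounded_measurableD.
- exact: bm.
rewrite meanD// meanZ; last exact: bm.
congr (_ + _); rewrite /h mean_sum//; apply: eq_bigr => y _.
rewrite meanZ ?mean_posterior 1?mulrC//.
exact: bounded_measurable_simplex simplex_posterior measurable_posterior.
Qed.

End posterior.

Lemma affinely_related_universally_equivalent (R : realType) (k : nat)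
    (pi : 'rV[R]_k) (L1 L2 : loss R k) :
  simplex pi -> bounded_below L1 -> bounded_below L2 ->
  proper_risks (risk_vectors L1) -> proper_risks (risk_vectors L2) ->
  affinely_related pi (risk_vectors L1) (risk_vectors L2) ->
  universally_equivalent pi L1 L2.
Proof.
move=> spi bL1 bL2 pS1 pS2 [a [c [a0 rel]]].
move=> d d1 d2 X Z1 Z2 P q1 q2 post1 post2 mq1 mq2 post1P post2P.
rewrite !(informationE spi mq1 post1P)// !(informationE spi mq2 post2P)//.
rewrite !lee_fin !lerD2l !lerN2.
rewrite (mean_affinely_related spi mq1 post1P pS1 pS2 rel).
rewrite (mean_affinely_related spi mq2 post2P pS1 pS2 rel).
by rewrite lerD2r ler_pM2l.
Qed.

Theorem theorem2 (R : realType) (n : nat) (pi : 'rV[R]_n.+1)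
    (L1 L2 : loss R n.+1)
    (pi_simplex : simplex pi)
    (L1_bounded : bounded_below L1) (L2_bounded : bounded_below L2)
    (H1_finite : (entropy L1 pi < +oo)%E) (H2_finite : (entropy L2 pi < +oo)%E) :
  universally_equivalent pi L1 L2 <->
  exists (a : R) (b : 'rV[R]_n) (c : R),
    0 < a /\
    forall t : 'rV[R]_n, nonneg_orthant t ->
      f_pi L1 pi t =
      (a%:E * f_pi L2 pi t + (\sum_(i < n) b 0%R i * t 0%R i + c)%:E)%E.
Proof.
have pS1 := proper_risk_vectors L1_bounded H1_finite.
have pS2 := proper_risk_vectors L2_bounded H2_finite.
have [pi0 _] := pi_simplex.
apply: (@iff_trans _ (affinely_related pi (risk_vectors L1) (risk_vectors L2))).
  split; first exact: universally_equivalent_affinely_related.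
  exact: affinely_related_universally_equivalent.
apply: (iff_trans (affinely_related_f pS1 pS2 pi0)).
split=> -[a [b [c [a0 rel]]]]; exists a, b, c; split=> // t t0.
  by rewrite !f_piE// -EFinM -EFinD rel.
by have := rel t t0; rewrite !f_piE// -EFinM -EFinD => -[].
Qed.
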